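(* Let $n,m\in\mathbb{N}$ with $n,m\ge1$ and $\kappa\in(0,+\infty)$. The unique stationary distribution of the edge reconnecting model with linear preferential attachment parameter $\kappa$ and state space $\mathcal{A}_n^m$ is the same as the distribution of $\mathrm{PAG}_\kappa(n,m)$ (viewed as a random element of $\mathcal{A}_n^m$). Moreover, if $\mathbf{X}_n$ has this distribution then for all $B\in\mathcal{A}_n^m$ $$\mathbf{P}(\mathbf{X}_n=B)=\frac{\prod_{i=1}^n\prod_{j=1}^{d(B,i)}(\kappa+j-1)}{\prod_{j=1}^{2m}(\kappa n+j-1)}\cdot\frac{m!\,2^{m'(B)}}{\Big(\prod_{i=1}^n\prod_{j=1}^{i-1}B(i,j)!\Big)\Big(\prod_{i=1}^n\frac{B(i,i)}{2}!\Big)},$$ where $m'(B)=\sum_{i=1}^n\sum_{j=1}^{i-1}B(i,j)$ is the number of non-loop edges.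
   Context: $\mathbb{N}_0=\{0,1,2,\dots\}$, $[n]=\{1,\dots,n\}$. $\mathcal{A}_n$ is the set of symmetric matrices $B\in\mathbb{N}_0^{n\times n}$ with $B(i,i)$ even for all $i$ (adjacency matrices of labeled multigraphs on $[n]$, parallel and loop edges allowed; $B(i,j)$ is the number of edges between $i\ne j$ and $B(i,i)$ is twice the number of loops at $i$). The degree is $d(B,i)=\sum_{j=1}^nB(i,j)$ and the number of edges is $\frac12\sum_{i=1}^n d(B,i)$. $\mathcal{A}_n^m$ is the set of $B\in\mathcal{A}_n$ with exactly $m$ edges. Empty products equal $1$. Edge reconnecting model: the Markov chain on $\mathcal{A}_n^m$ (labeled multigraphs on $[n]$ with $m$ edges) in which one step is: choose one of the $m$ edges uniformly at random (parallel edges counted separately), choose one of its two endpoints by a fair coin flip, and reconnect that end of the edge to a new endpoint, which is vertex $v$ with probability $\frac{d(v)+\kappa}{2m+n\kappa}$, where $d(v)$ is the degree of $v$ in the multigraph before the step. This chain is irreducible and aperiodic on $\mathcal{A}_n^m$. $\mathrm{PAG}_\kappa(n,m)$: let $V=\{v_1,\dots,v_n\}$ (identified with $[n]$). Generate a random sequence $v_1^*,\dots,v_{2m}^*$ of elements of $V$ one by one, starting from the empty sequence: given $v^*_1,\dots,v^*_L$, the next element $v_{L+1}^*$ equals $v\in V$ with probability $\frac{d(v)+\kappa}{L+n\kappa}$, where $d(v)$ is the multiplicity of $v$ in $v_1^*,\dots,v_L^*$. $\mathrm{PAG}_\kappa(n,m)$ is the random multigraph on $V$ with edges $\{v^*_{2k-1},v^*_{2k}\}$,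 $k=1,\dots,m$ (a loop if the two coincide). *)

(* Defs.v *)
From HB Require Import structures.
From mathcomp Require Import all_boot all_order all_algebra.
From mathcomp Require Import reals.

Set Implicit Arguments.
Unset Strict Implicit.
Unset Printing Implicit Defensive.

Import Order.TTheory GRing.Theory Num.Theory.
Local Open Scope ring_scope.

Section AdjacencyMatrices.
Variable n : nat.
Implicit Types B : 'M[nat]_n.

Definition adjacency B : bool :=
  (B^T == B) && [forall i, ~~ odd (B i i)].

Definition deg B (i : 'I_n) : nat := (\sum_(j < n) B i j)%N.

(* The degree sum of an adjacency matrix is even, so the halving is exact. *)
Definition nedges B : nat := (\sum_(i < n) deg B i)%N./2.

Definition nonloops B : nat :=
  (\sum_(i < n) \sum_(j < n | (j < i)%N) B i j)%N.

(* The number of edges with endpoints i and j: the diagonal counts loops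
   twice. *)
Definition edge_mult B (i j : 'I_n) : nat :=
  if i == j then (B i i)./2 else B i j.

(* The adjacency matrix of a single edge; for a = b it is 2 at (a, a). *)
Definition edge_mx (a b : 'I_n) : 'M[nat]_n := delta_mx a b + delta_mx b a.

(* B with one edge {a, b} replaced by {v, b}.  The truncated subtraction is
   exact as soon as B has an edge {a, b}. *)
Definition reconnect B (a b v : 'I_n) : 'M[nat]_n :=
  \matrix_(i, j) (B i j - edge_mx a b i j + edge_mx v b i j)%N.

End AdjacencyMatrices.

Record multigraph (n m : nat) := Multigraph {
  adjmx :> 'M[nat]_n;
  _ : adjacency adjmx && (nedges adjmx == m)
}.

HB.instance Definition _ n m := [isSub for @adjmx n m].
HB.instance Definition _ n m := [Choice of multigraph n m by <:].

(* There are finitely many such multigraphs: the entries are at most 2m. *)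
Section MultigraphFinite.
Variables n m : nat.

Lemma multigraph_entry_lt (B : multigraph n m) i j : (B i j < (2 * m).+2)%N.
Proof.
case: B => B /= /andP[_ /eqP <-].
apply: (@leq_ltn_trans (\sum_(i < n) deg B i)%N).
  rewrite (bigD1 i) //= /deg (bigD1 j) //= -addnA; exact: leq_addr.
by rewrite -{1}(odd_double_half (\sum_(i < n) deg B i)%N) -mul2n /nedges;
  case: odd; rewrite ?add1n ?add0n.
Qed.

Definition multigraph_code (B : multigraph n m) : 'M['I_(2 * m).+2]_n :=
  map_mx inord (adjmx B).
Definition multigraph_decode (C : 'M['I_(2 * m).+2]_n) :
  option (multigraph n m) := insub (map_mx (@nat_of_ord _) C).

Lemma multigraph_codeK : pcancel multigraph_code multigraph_decode.
Proof.
move=> B; rewrite /multigraph_decode /multigraph_code.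
have -> : map_mx (@nat_of_ord _) (map_mx (@inord (2 * m).+1) (adjmx B)) = adjmx B.
  by apply/matrixP => i j; rewrite !mxE inordK // multigraph_entry_lt.
exact: valK.
Qed.

HB.instance Definition _ : isCountable (multigraph n m) :=
  PCanIsCountable multigraph_codeK.
HB.instance Definition _ : isFinite (multigraph n m) :=
  PCanIsFinite multigraph_codeK.

End MultigraphFinite.

Section MarkovChains.
Variables (R : realType) (S : finType).

Definition is_distribution (mu : {ffun S -> R}) : Prop :=
  (forall x, 0 <= mu x) /\ \sum_(x : S) mu x = 1.

Definition stationary (P : S -> S -> R) (mu : {ffun S -> R}) : Prop :=
  is_distribution mu /\ forall y, mu y = \sum_(x : S) mu x * P x y.

End MarkovChains.

Section Models.
Variables (R : realType) (n m : nat) (kappa : R).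

(* Unordered pairs of endpoints are indexed by j <= i.  The boolean b is the
   coin flip that decides which of the ends i, j is moved. *)
Definition edge_reconnecting (B B' : multigraph n m) : R :=
  \sum_(i < n) \sum_(j < n | (j <= i)%N) (edge_mult B i j)%:R / m%:R *
    \sum_(b : bool) 2^-1 *
      \sum_(v < n) ((deg B v)%:R + kappa) / ((2 * m)%:R + n%:R * kappa) *
        (reconnect B (if b then i else j) (if b then j else i) v
           == adjmx B')%:R.

Definition pag_sequence_prob (s : (2 * m).-tuple 'I_n) : R :=
  \prod_(L < 2 * m)
    (((count_mem (tnth s L) (take L s))%:R + kappa) / (L%:R + n%:R * kappa)).

Fixpoint pag_mx (s : seq 'I_n) : 'M[nat]_n :=
  if s is a :: b :: s' then edge_mx a b + pag_mx s' else 0.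

Definition PAG : {ffun multigraph n m -> R} :=
  [ffun B => \sum_(s : (2 * m).-tuple 'I_n | pag_mx s == adjmx B)
               pag_sequence_prob s].

End Models.

(* Main.v *)
(* The sequence generated by the Polya urn is exchangeable: its probability is
   prod_v kappa (kappa + 1) ... (kappa + d(v) - 1) up to normalization.
   Replacing a uniformly chosen entry of a sequence of length 2m by a fresh
   urn draw is therefore reversible, and pairing consecutive entries maps this
   chain on sequences onto the edge reconnecting chain.  Changing the entries
   one at a time connects any two sequences, so the chain is irreducible, and
   by the maximum principle every stationary distribution is proportional to
   the reversible one.  The formula follows because all sequences of a
   multigraph have the same probability; they are counted by induction on m,
   removing the first edge. *)
Require Import Defs.
From mathcomp Require Import all_boot all_order all_algebra.
From mathcomp Require Import reals.
From mathcomp Require Import ring zify.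

Set Implicit Arguments.
Unset Strict Implicit.
Unset Printing Implicit Defensive.

Import Order.TTheory GRing.Theory Num.Theory.
Local Open Scope ring_scope.

Lemma sum_tuple_cons (T : finType) (V : nmodType) k (F : seq T -> V) :
  \sum_(s : k.+1.-tuple T) F s = \sum_a \sum_(s : k.-tuple T) F (a :: s).
Proof.
rewrite pair_big /=.
rewrite (reindex (fun p : T * k.-tuple T => [tuple of p.1 :: p.2])) //=.
exists (fun s : k.+1.-tuple T => (thead s, [tuple of behead s])) => [[a s] _|s _] /=.
  by congr (_, _); apply/val_inj.
by rewrite [RHS]tuple_eta; apply/val_inj.
Qed.

(** * Polya urn weights of vertex sequences *)

Section Sequences.
Variables (R : realType) (n : nat).
Implicit Types (s t : seq 'I_n) (a b u v : 'I_n).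

Definition rising (x : R) (d : nat) : R := \prod_(j < d) (x + j%:R).

Lemma risingS x d : rising x d.+1 = rising x d * (x + d%:R).
Proof. by rewrite /rising big_ord_recr. Qed.

Lemma risingE x d : rising x d = \prod_(1 <= j < d.+1) (x + j%:R - 1).
Proof.
rewrite big_add1 /= big_mkord; apply: eq_bigr => j _.
by rewrite -addn1 natrD addrA addrK.
Qed.

Lemma rising_gt0 x d : 0 < x -> 0 < rising x d.
Proof. by move=> x0; apply: prodr_gt0 => j _; rewrite ltr_wpDr. Qed.

(** The numerator of the urn probability of [s]; written through multiplicities, it is visibly
    independent of the order of the draws. *)
Definition urn_weight (kappa : R) s : R := \prod_v rising kappa (count_mem v s).

Lemma urn_weight_cons kappa a s :
  urn_weight kappa (a :: s) = urn_weight kappa s * ((count_mem a s)%:R + kappa).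
Proof.
rewrite /urn_weight (bigD1 a) //= eqxx add1n risingS [in RHS](bigD1 a) //=.
rewrite mulrAC [kappa + _]addrC; congr (_ * _ * _).
by apply: eq_bigr => v /negPf av; rewrite eq_sym av.
Qed.

Lemma perm_urn_weight kappa s t :
  perm_eq s t -> urn_weight kappa s = urn_weight kappa t.
Proof. by move=> /permP st; apply: eq_bigr => v _; rewrite st. Qed.

Lemma urn_weight_gt0 kappa s : 0 < kappa -> 0 < urn_weight kappa s.
Proof. by move=> k0; apply: prodr_gt0 => v _; apply: rising_gt0. Qed.

Lemma sum_count_mem s : (\sum_v count_mem v s = size s)%N.
Proof.
elim: s => [|a s IH] /=; first by rewrite big1.
rewrite big_split /= IH (bigD1 a) //= eqxx big1 // => v av.
by rewrite eq_sym (negPf av).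
Qed.

Lemma sum_count_memR kappa s :
  \sum_v ((count_mem v s)%:R + kappa) = (size s)%:R + n%:R * kappa :> R.
Proof.
by rewrite big_split /= -natr_sum sum_count_mem sumr_const card_ord mulr_natl.
Qed.

(** The last factor sees the whole prefix, hence induction from the right. The recursion of
    [urn_weight] works at the head, and permutation invariance carries the last draw there. *)
Lemma urn_prob_seq kappa a0 s :
  \prod_(L < size s) (((count_mem (nth a0 s L) (take L s))%:R + kappa)
                      / (L%:R + n%:R * kappa))
  = urn_weight kappa s / rising (n%:R * kappa) (size s).
Proof.
elim/last_ind: s => [|s a IH].
  by rewrite big_ord0 /urn_weight big1 ?/rising ?big_ord0 ?divr1 // => v _; rewrite big_ord0.
rewrite size_rcons big_ord_recr /= nth_rcons ltnn eqxx -cats1 take_size_cat //.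
rewrite (eq_bigr (fun L : 'I_(size s) =>
   ((count_mem (nth a0 s L) (take L s))%:R + kappa) / (L%:R + n%:R * kappa))); last first.
  by move=> L _; rewrite nth_cat ltn_ord takel_cat // ltnW.
have -> : urn_weight kappa (s ++ [:: a]) = urn_weight kappa (a :: s).
  by apply: perm_urn_weight; rewrite cats1 perm_rcons.
by rewrite IH urn_weight_cons risingS invfM mulrACA [_%:R + n%:R * _]addrC.
Qed.

(** Summing out the head multiplies the weight by [k + n * kappa], the next factor of the rising
    factorial. *)
Lemma sum_urn_weight kappa k :
  \sum_(s : k.-tuple 'I_n) urn_weight kappa s = rising (n%:R * kappa) k.
Proof.
elim: k => [|k IH].
  rewrite (eq_bigr (fun=> 1)) => [|s _]; last first.
    by rewrite /urn_weight big1 // => v _; rewrite tuple0 /= /rising big_ord0.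
  by rewrite sumr_const card_tuple expn0 /rising big_ord0.
rewrite sum_tuple_cons exchange_big risingS -IH big_distrl; apply: eq_bigr => s _.
under eq_bigr do rewrite urn_weight_cons.
by rewrite -big_distrr /= sum_count_memR size_tuple addrC.
Qed.

Definition tuple_set k (s : k.-tuple 'I_n) (i : 'I_k) v : k.-tuple 'I_n :=
  [tuple if j == i then v else tnth s j | j < k].

Lemma tuple_setK k (s : k.-tuple 'I_n) i v :
  tuple_set (tuple_set s i v) i (tnth s i) = s.
Proof.
by apply: eq_from_tnth => j; rewrite !tnth_mktuple; case: eqP => // ->.
Qed.

Lemma tnth_tuple_set k (s : k.-tuple 'I_n) i v : tnth (tuple_set s i v) i = v.
Proof. by rewrite tnth_mktuple eqxx. Qed.

Lemma tuple_set_nth k (s : k.-tuple 'I_n) (i : 'I_k) v a0 :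
  tuple_set s i v = set_nth a0 s i v :> seq 'I_n.
Proof.
apply: (@eq_from_nth _ a0) => [|j].
  by rewrite size_set_nth !size_tuple (maxn_idPr _).
rewrite size_tuple => jk; rewrite nth_set_nth /= -[j]/(nat_of_ord (Ordinal jk)).
rewrite -(tnth_nth a0 (tuple_set s i v)) -(tnth_nth a0 s) tnth_mktuple.
by rewrite -val_eqE.
Qed.

Lemma perm_tuple_set k (s : k.-tuple 'I_n) i v :
  perm_eq (v :: s) (tnth s i :: tuple_set s i v).
Proof.
have cE p (t : k.-tuple 'I_n) : count p t = (\sum_j p (tnth t j))%N.
  by rewrite -sum1_count big_mkcond /= big_tuple; apply: eq_bigr => j _; case: (p _).
apply/permP => p; rewrite -(cat1s v) -(cat1s (tnth s i)) !count_cat !cE /= !addn0.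
rewrite (bigD1 i) //= [in RHS](bigD1 i) //= tnth_mktuple eqxx addnCA.
congr (_ + (_ + _))%N.
by apply: eq_bigr => j /negPf ji; rewrite tnth_mktuple ji.
Qed.

(* Both sides are the weight of the sequence of length k + 1 that contains the
   old and the new entry. *)
Lemma urn_detailed_balance kappa k (s : k.-tuple 'I_n) i v :
  urn_weight kappa s * ((count_mem v s)%:R + kappa)
  = urn_weight kappa (tuple_set s i v)
    * ((count_mem (tnth s i) (tuple_set s i v))%:R + kappa).
Proof. by rewrite -!urn_weight_cons; apply/perm_urn_weight/perm_tuple_set. Qed.

(** The map sending a sequence and a draw to the modified sequence and the displaced entry is an
    involution, and detailed balance says that it preserves the weight. *)
Lemma urn_reversible kappa k (i : 'I_k) (F G : k.-tuple 'I_n -> R) :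
  \sum_(s : k.-tuple 'I_n) \sum_v urn_weight kappa s * ((count_mem v s)%:R + kappa)
    * (F s * G (tuple_set s i v))
  = \sum_(s : k.-tuple 'I_n) \sum_v urn_weight kappa s * ((count_mem v s)%:R + kappa)
    * (F (tuple_set s i v) * G s).
Proof.
rewrite !pair_big /=.
pose f (p : k.-tuple 'I_n * 'I_n) := (tuple_set p.1 i p.2, tnth p.1 i).
have fK : cancel f f.
  by case=> s v; rewrite /f /= tuple_setK tnth_tuple_set.
rewrite [RHS](reindex f) /=; last by exists f => p _; apply: fK.
by apply: eq_bigr => -[s v] _ /=; rewrite -urn_detailed_balance tuple_setK.
Qed.

End Sequences.

(** * Adjacency matrices built from sequences of edges *)

Section Multigraphs.
Variable n : nat.
Implicit Types (B C : 'M[nat]_n) (a b v : 'I_n) (s : seq 'I_n).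

Lemma edge_mxE a b i j :
  edge_mx a b i j = ((i == a) && (j == b) + (i == b) && (j == a))%N.
Proof. by rewrite !mxE !natn. Qed.

Lemma edge_mxC a b : edge_mx a b = edge_mx b a.
Proof. by rewrite /edge_mx addrC. Qed.

Lemma adjacencyP B :
  reflect ((forall i j, B i j = B j i) /\ forall i, ~~ odd (B i i)) (adjacency B).
Proof.
apply: (iffP andP) => -[sB oB]; split.
- by move=> i j; rewrite -{1}(eqP sB) mxE.
- by move=> i; apply: (forallP oB).
- by apply/eqP/matrixP => i j; rewrite mxE.
- by apply/forallP.
Qed.

Lemma adjacency_edge a b C : adjacency (edge_mx a b + C) = adjacency C.
Proof.
have E i j : (edge_mx a b + C) i j = (edge_mx a b i j + C i j)%N by rewrite mxE.
have sE i j : edge_mx a b i j = edge_mx a b j i.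
  by rewrite !edge_mxE addnC andbC [_ && (j == b)]andbC.
have oE i : ~~ odd (edge_mx a b i i).
  by rewrite edge_mxE andbC addnn odd_double.
apply/adjacencyP/adjacencyP => -[sB oB]; split.
- by move=> i j; have := sB i j; rewrite !E sE => /addnI.
- by move=> i; have := oB i; rewrite E oddD (negPf (oE i)).
- by move=> i j; rewrite !E sE sB.
- by move=> i; rewrite E oddD (negPf (oE i)) oB.
Qed.

Lemma deg_edge a b C v : deg (edge_mx a b + C) v = ((a == v) + (b == v) + deg C v)%N.
Proof.
rewrite /deg; under eq_bigr do rewrite mxE.
rewrite big_split /=; congr (_ + _)%N; under eq_bigr do rewrite edge_mxE.
rewrite big_split /= (bigD1 b) //= (bigD1 a (P := xpredT)) //= !eqxx !andbT.
rewrite !big1 ?addn0 1?eq_sym 1?[b == _]eq_sym //.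
- by move=> j /negPf ->; rewrite andbF.
- by move=> j /negPf ->; rewrite andbF.
Qed.

Lemma sum_edge_deg a b C :
  (\sum_v deg (edge_mx a b + C) v = (\sum_v deg C v).+2)%N.
Proof.
have S1 (x : 'I_n) : (\sum_v (x == v) = 1)%N.
  by rewrite (bigD1 x) //= eqxx big1 // => v /negPf; rewrite eq_sym => ->.
by under eq_bigr do rewrite deg_edge; rewrite !big_split /= !S1.
Qed.

Lemma nedges_edge a b C : nedges (edge_mx a b + C) = (nedges C).+1.
Proof. by rewrite /nedges sum_edge_deg. Qed.

(** Induction following [pag_mx], which consumes two entries at a time. *)
Lemma seq2_ind (P : seq 'I_n -> Prop) : P [::] ->
  (forall a b s, ~~ odd (size s) -> P s -> P (a :: b :: s)) ->
  forall s, ~~ odd (size s) -> P s.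
Proof.
move=> P0 PS s; have [k] := ubnP (size s).
elim: k s => // k IH [|a [|b s]] //= sk; rewrite negbK => os.
by apply: PS => //; apply: IH => //; apply: ltnW.
Qed.

Lemma pag_mx_adjacency s : ~~ odd (size s) -> adjacency (pag_mx s).
Proof.
move: s; apply: seq2_ind => [|a b s _ IH] /=; last by rewrite adjacency_edge.
by apply/adjacencyP; split=> [i j|i]; rewrite !mxE.
Qed.

Lemma deg0 v : deg (0 : 'M[nat]_n) v = 0%N.
Proof. by rewrite /deg big1 // => j _; rewrite mxE. Qed.

Lemma pag_mx_deg s v : ~~ odd (size s) -> deg (pag_mx s) v = count_mem v s.
Proof.
move: s; apply: seq2_ind => [|a b s _ IH] /=; first exact: deg0.
by rewrite deg_edge IH addnA.
Qed.

Lemma pag_mx_nedges s : ~~ odd (size s) -> nedges (pag_mx s) = (size s)./2.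
Proof.
move: s; apply: seq2_ind => [|a b s _ IH] /=; last by rewrite nedges_edge IH.
by rewrite /nedges big1 // => v _; apply: deg0.
Qed.

(** Halving is additive here because the diagonal entries of [edge_mx a b] are even. *)
Lemma edge_mult_edge a b C i j :
  edge_mult (edge_mx a b + C) i j
  = (edge_mult (edge_mx a b) i j + edge_mult C i j)%N.
Proof.
have E k l : (edge_mx a b + C) k l = (edge_mx a b k l + C k l)%N by rewrite mxE.
rewrite /edge_mult !E; case: eqP => [_|//]; rewrite edge_mxE.
by rewrite [(i == b) && _]andbC addnn halfD odd_double doubleK.
Qed.

(** The unordered edge gets one representative [(x, y)] with [y <= x], matching the index range of
    the edge sum in the chain. *)
Lemma edge_mult_edge_mx a b : exists x y : 'I_n,
  [/\ (y <= x)%N, (x = a /\ y = b) \/ (x = b /\ y = a) &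
      forall i j : 'I_n, (j <= i)%N ->
        edge_mult (edge_mx a b) i j = (i == x) && (j == y) :> nat].
Proof.
wlog ba : a b / (b <= a)%N => [W|].
  case: (leqP b a) => [/W//|/ltnW/W [x [y [yx xyE e]]]].
  exists x, y; split=> // [|i j ji]; last by rewrite edge_mxC e.
  by case: xyE; [right|left].
exists a, b; split=> // [|i j ji]; first by left.
rewrite /edge_mult; case: (eqVneq i j) => [->|ij].
  by rewrite edge_mxE [(j == b) && _]andbC addnn doubleK.
rewrite edge_mxE [(i == b) && _](_ : _ = false) ?addn0 //.
apply/negP => /andP[/eqP ib /eqP ja]; move/negP: ij; apply.
by rewrite ib ja -val_eqE /= eqn_leq ba -ib -ja ji.
Qed.

(* C carries the edges already treated in the induction on s. *)
Lemma sum_reconnect (V : pzRingType) (F : 'M[nat]_n -> V) a0 v s C :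
  ~~ odd (size s) ->
  \sum_(k < size s) F (C + pag_mx (set_nth a0 s k v))
  = \sum_(i < n) \sum_(j < n | (j <= i)%N) (edge_mult (pag_mx s) i j)%:R *
      (F (reconnect (C + pag_mx s) i j v) + F (reconnect (C + pag_mx s) j i v)).
Proof.
move=> os; move: s os C; apply: seq2_ind => [|a b s _ IH] C.
  rewrite big_ord0 big1 // => i _; rewrite big1 // => j _.
  by rewrite /edge_mult !mxE if_same mul0r.
rewrite /= !big_ord_recl /=.
have -> : \sum_(k < size s) F (C + (edge_mx a b + pag_mx (set_nth a0 s k v)))
        = \sum_(k < size s) F (C + edge_mx a b + pag_mx (set_nth a0 s k v)).
  by apply: eq_bigr => k _; rewrite addrA.
(* The first edge joins the treated ones, so the total matrix is unchanged. *)
rewrite IH -[C + edge_mx a b + _]addrA.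
(* Both ends of an edge may move, which makes [g] symmetric: either orientation of the first edge
   can serve as its representative. *)
pose g i j := F (reconnect (C + (edge_mx a b + pag_mx s)) i j v)
            + F (reconnect (C + (edge_mx a b + pag_mx s)) j i v).
have gC i j : g i j = g j i by rewrite /g addrC.
under [RHS]eq_bigr do under eq_bigr do
  rewrite edge_mult_edge natrD mulrDl -/(g _ _).
under [RHS]eq_bigr do rewrite big_split.
rewrite big_split /= [LHS]addrA; congr (_ + _).
(* Positions 0 and 1 hold the two ends of the first edge. Since this edge is a summand of the
   matrix, the truncated subtraction in [reconnect] is exact. *)
have -> : F (C + (edge_mx v b + pag_mx s)) + F (C + (edge_mx a v + pag_mx s)) = g a b.
  rewrite /g; congr (F _ + F _); apply/matrixP => i j; rewrite !mxE ?natn;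
  lia.
have [x [y [yx xyE eE]]] := edge_mult_edge_mx a b.
have -> : g a b = g x y by case: xyE => [[-> ->]|[-> ->]].
rewrite (bigD1 x) //= (bigD1 y) //= eE // !eqxx mul1r big1 ?addr0 => [|j].
  rewrite big1 ?addr0 // => i /negPf ix; rewrite big1 // => j ji.
  by rewrite eE // ix mul0r.
by case/andP=> jx /negPf jy; rewrite eE // jy andbF mul0r.
Qed.

End Multigraphs.

(** * Counting the sequences that yield a given multigraph *)

Section Counting.
Variables (R : realType) (n : nat).
Implicit Types (B C : 'M[nat]_n) (a b v : 'I_n).

(** Times [m!], this is the number of sequences of an [m]-edge multigraph: orderings of the edges
    and orientations of the non-loops, modulo permutations of parallel edges and of loops at a
    vertex. *)
Definition pairing_weight B : R :=
  2 ^+ nonloops B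
  / ((\prod_(i < n) \prod_(j < n | (j < i)%N) ((B i j)`!)%:R)
     * (\prod_(i < n) (((B i i)./2)`!)%:R)).

Lemma pairing_weight_gt0 B : 0 < pairing_weight B.
Proof.
apply: divr_gt0; first exact: exprn_gt0.
apply: mulr_gt0; apply: prodr_gt0 => i _; last by rewrite ltr0n fact_gt0.
by apply: prodr_gt0 => j _; rewrite ltr0n fact_gt0.
Qed.

(** A new non-loop brings a factor 2 for its orientation and divides by the new multiplicity, which
    is the matrix entry. A new loop brings no factor 2, but its entry is twice the new number of
    loops. Both cases thus obey one recursion. *)
Lemma pairing_weight_edge a b C : adjacency C ->
  pairing_weight (edge_mx a b + C) * ((edge_mx a b + C)%R a b)%:R
  = 2 * pairing_weight C.
Proof.
move=> aC.
wlog ba : a b / (b <= a)%N => [W|].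
  case: (leqP b a) => [/W//|/ltnW/W].
  have aB : adjacency (edge_mx b a + C) by rewrite adjacency_edge.
  by case/adjacencyP: aB => ->; rewrite (edge_mxC b a).
set B := edge_mx a b + C.
have BE i j : B i j = (edge_mx a b i j + C i j)%N by rewrite mxE.
(* As [b <= a], at most one of the two elementary matrices of the edge reaches below the
   diagonal. *)
have loE (i j : 'I_n) : (j < i)%N -> B i j = (((i, j) == (a, b)) + C i j)%N.
  move=> ji; rewrite BE edge_mxE xpair_eqE [(i == b) && _](_ : _ = false) ?addn0 //.
  by apply/negP => /andP[/eqP ib /eqP ja]; move: ji; rewrite ib ja ltnNge ba.
have diE i : (B i i)./2 = (((i, i) == (a, b)) + (C i i)./2)%N.
  rewrite BE edge_mxE xpair_eqE [(i == b) && _]andbC addnn halfD.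
  by rewrite odd_double doubleK.
have ffne0 d : (d`!)%:R != 0 :> R by rewrite pnatr_eq0 -lt0n fact_gt0.
have ne0 (T : finType) (P : pred T) (f : T -> nat) : \prod_(i | P i) ((f i)`!)%:R != 0 :> R.
  by apply/prodf_neq0.
have Sne0 d : 1 + d%:R != 0 :> R by rewrite nat1r pnatr_eq0.
rewrite /pairing_weight /nonloops !pair_big_dep /=.
have [ab|ab] := eqVneq a b.
  have oE (p : 'I_n * 'I_n) : (p.2 < p.1)%N -> B p.1 p.2 = C p.1 p.2.
    move=> lp; rewrite loE // ab xpair_eqE.
    by case: eqP => // p1; case: eqP => // p2; move: lp; rewrite p1 p2 ltnn.
  rewrite (eq_bigr _ oE) (eq_bigr _ (fun p lp => congr1 (fun d => (d`!)%:R) (oE p lp))).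
  rewrite (bigD1 a) //= [in RHS](bigD1 a (P := xpredT)) //=.
  rewrite (eq_bigr (fun i => (((C i i)./2)`!)%:R)); last first.
    by move=> i ia; rewrite diE xpair_eqE (negPf ia).
  have -> : (B a b)%:R = 2 * ((C a a)./2.+1)%:R :> R.
    rewrite -natrM; congr (_%:R); rewrite BE edge_mxE -ab !eqxx.
    case/adjacencyP: aC => _ /(_ a) /even_halfK; lia.
  rewrite diE -ab eqxx factS natrM.
  by field; rewrite !ne0 ffne0 Sne0.
have ltba : (b < a)%N by rewrite ltn_neqAle ba andbT eq_sym.
have dE i : (((B i i)./2)`!)%:R = (((C i i)./2)`!)%:R :> R.
  rewrite diE xpair_eqE; case: eqP => //= ia.
  by rewrite -ia in ab; rewrite (negPf ab).
rewrite (eq_bigr _ (fun i _ => dE i)).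
rewrite (bigD1 (a, b)) //= [\prod_(p | _) ((B _ _)`!)%:R](bigD1 (a, b)) //=.
rewrite [in RHS](bigD1 (a, b)) //= [\prod_(p | _) ((C _ _)`!)%:R](bigD1 (a, b)) //=.
have oE (p : 'I_n * 'I_n) : (p.2 < p.1)%N && (p != (a, b)) -> B p.1 p.2 = C p.1 p.2.
  by case: p => i j /andP[ji /negPf ne]; rewrite loE // ne.
rewrite (eq_bigr _ oE) (eq_bigr _ (fun p lp => congr1 (fun d => (d`!)%:R) (oE p lp))).
rewrite loE // eqxx add1n factS natrM addSn exprS.
by field; rewrite !ne0 ffne0 Sne0.
Qed.

(** By symmetry each entry below the diagonal is counted twice, and the diagonal entries are even,
    so the halving in [nedges] loses nothing. *)
Lemma sum_degE B : adjacency B -> (\sum_i deg B i = (nedges B).*2)%N.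
Proof.
case/adjacencyP => sB oB; rewrite /nedges halfK.
suff -> : odd (\sum_i deg B i) = false by rewrite subn0.
have -> : (\sum_i deg B i = (\sum_(i < n) \sum_(j < n | (j < i)%N) B i j).*2
                            + (\sum_i (B i i)./2).*2)%N.
  transitivity (\sum_(i < n) (\sum_(j < n | (j < i)%N) B i j
    + (\sum_(j < n | (i < j)%N) B i j + B i i)))%N.
    apply: eq_bigr => i _; rewrite /deg (bigID (fun j : 'I_n => (j < i)%N)) /=.
    congr (_ + _)%N; rewrite (bigD1 i) ?ltnn //= addnC; congr (_ + _)%N.
    by apply: eq_bigl => j; rewrite -leqNgt ltn_neqAle andbC eq_sym.
  rewrite !big_split /= addnA -addnn; congr (_ + _ + _)%N.
    rewrite (exchange_big_dep xpredT) //=.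
    by apply: eq_bigr => i _; apply: eq_bigr => j _.
  rewrite -muln2 big_distrl /=; apply: eq_bigr => i _.
  by rewrite muln2 even_halfK.
by rewrite oddD !odd_double.
Qed.

(** Fixing the first edge as [(a, b)] leaves a count proportional to [B a b]; summing over all pairs
    gives the degree sum [2 * (m + 1)], which supplies the next factor of the factorial. *)
Lemma sum_pag_mx m B : adjacency B -> nedges B = m ->
  \sum_(s : m.*2.-tuple 'I_n) (pag_mx s == B)%:R = (m`!)%:R * pairing_weight B.
Proof.
elim: m B => [|m IH] B aB eB.
  have B0 : B = 0.
    have := sum_degE aB; rewrite eB => /eqP; rewrite sum_nat_eq0 => /forallP z.
    apply/matrixP => i j; rewrite mxE.
    by have := z i; rewrite /= sum_nat_eq0 => /forallP /(_ j) /eqP.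
  rewrite (eq_bigr (fun=> 1)) => [|s _]; last by rewrite tuple0 /= B0 eqxx.
  rewrite sumr_const card_tuple expn0 fact0 mul1r B0 /pairing_weight /nonloops.
  rewrite big1 ?expr0 => [|i _]; last by rewrite big1 // => j _; rewrite mxE.
  rewrite big1 => [|i _]; last by rewrite big1 // => j _; rewrite mxE.
  by rewrite big1 => [|i _]; rewrite ?mxE // mulr1 divr1.
rewrite doubleS (sum_tuple_cons _ (fun s => (pag_mx s == B)%:R)).
under eq_bigr => a _ do
  rewrite (sum_tuple_cons _ (fun s => (pag_mx (a :: s) == B)%:R)) /=.
have step a b : \sum_(s : m.*2.-tuple 'I_n) (edge_mx a b + pag_mx s == B)%:R
  = (m`!)%:R * pairing_weight B / 2 * (B a b)%:R.
  have [B0|Bgt0] := posnP (B a b).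
    rewrite B0 mulr0 big1 // => s _; case: eqP => // /matrixP /(_ a b).
    by rewrite B0 mxE edge_mxE !eqxx.
  pose C : 'M[nat]_n := \matrix_(i, j) (B i j - edge_mx a b i j)%N.
  have BC : edge_mx a b + C = B.
    apply/matrixP => i j.
    have -> : (edge_mx a b + C) i j = (edge_mx a b i j + (B i j - edge_mx a b i j))%N.
      by rewrite mxE [C i j]mxE.
    (* The subtraction is exact: for [a = b] the edge takes 2 from a positive even entry, and
       otherwise it takes 1 from [B a b] and from [B b a]. *)
    case/adjacencyP: aB => sB oB; apply: subnKC; rewrite edge_mxE.
    case: (altP andP) => [[/eqP -> /eqP ->]|_].
      case: eqVneq => [ab|_]; last by [].
      by move: (oB a) Bgt0; rewrite ab; case: (B b b) => [|[]].
    by case: andP => // -[/eqP -> /eqP ->]; rewrite sB.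
  have aC : adjacency C by rewrite -(adjacency_edge a b) BC.
  have eC : nedges C = m by move: eB; rewrite -BC nedges_edge => -[].
  have kE := pairing_weight_edge a b aC; rewrite BC in kE.
  rewrite (eq_bigr (fun s : m.*2.-tuple 'I_n => (pag_mx s == C)%:R)) => [|s _].
    by rewrite IH // mulrAC -[_ * _ * (B a b)%:R]mulrA kE; field.
  congr (nat_of_bool _)%:R; rewrite -BC; apply/eqP/eqP => [/matrixP e|-> //].
  by apply/matrixP => i j; have := e i j; rewrite !mxE => /addnI.
under eq_bigr do (under eq_bigr do rewrite step; rewrite -mulr_sumr -natr_sum).
rewrite -mulr_sumr -natr_sum sum_degE // eB -muln2 natrM factS natrM.
by field.
Qed.

End Counting.

(** By reversibility, stationarity of [mu] makes [mu / pi] harmonic for [P]. The set where this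
    ratio is maximal is closed under transitions of positive probability, hence is everything, and
    comparing total masses gives the ratio 1. Irreducibility is stated through closed sets, so that
    no powers of [P] appear. *)
Lemma eq_stationary_reversible (R : realType) (S : finType) (P : S -> S -> R)
    (pi mu : {ffun S -> R}) :
  (forall x, 0 < pi x) -> is_distribution pi ->
  (forall x y, 0 <= P x y) -> (forall x, \sum_y P x y = 1) ->
  (forall x y, pi x * P x y = pi y * P y x) ->
  (forall A : {pred S}, (exists x, x \in A) ->
     (forall x y, x \in A -> 0 < P x y -> y \in A) -> forall x, x \in A) ->
  stationary P mu -> mu = pi.
Proof.
move=> pi0 [_ pi1] P0 P1 rev irr [[mu0 mu1] muP].
pose h x := mu x / pi x.
have muE x : mu x = h x * pi x by rewrite /h divfK // gt_eqF.
have harm y : h y = \sum_x P y x * h x.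
  apply: (mulIf (lt0r_neq0 (pi0 y))); rewrite -muE muP big_distrl /=.
  by apply: eq_bigr => x _; rewrite muE -mulrA rev; ring.
(* Total mass 1 excludes an empty state space; the arg max needs a starting point. *)
have [x0 _] : exists x0 : S, true.
  have /eqP := pi1; case: (pickP (@predT S)) => [x _ _|z]; first by exists x.
  by rewrite big_pred0 // eq_sym oner_eq0.
pose M := [arg max_(x > x0) h x]%O.
have hM x : h x <= h M by rewrite /M; case: arg_maxP => // i _; apply.
have hE x : h x = h M.
  apply/eqP; apply: (irr [pred x | h x == h M]); first by exists M; rewrite inE.
  move=> y z; rewrite !inE => /eqP hy Pyz.
  (* At a maximum the average of the nonnegative gaps is 0, so the gap vanishes wherever [P y] is
     positive. *)
  have /eqP : \sum_x P y x * (h M - h x) = 0.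
    under eq_bigr do rewrite mulrBr.
    by rewrite sumrB -big_distrl /= P1 mul1r -harm hy subrr.
  rewrite psumr_eq0 => [/allP /(_ z)|w _]; last by rewrite mulr_ge0 // subr_ge0.
  by rewrite mem_index_enum mulf_eq0 gt_eqF //= subr_eq0 eq_sym => /(_ isT).
have hM1 : h M = 1.
  by rewrite -mu1 -[LHS]mulr1 -pi1 big_distrr; apply: eq_bigr => x _; rewrite muE hE.
by apply/ffunP => x; rewrite muE hE hM1 mul1r.
Qed.

(** * The edge reconnecting chain as the image of the chain on sequences *)

Section Chain.
Variables (R : realType) (n m : nat) (kappa : R).
Hypotheses (hn : (1 <= n)%N) (hm : (1 <= m)%N) (hkappa : 0 < kappa).

Notation total := ((2 * m)%:R + n%:R * kappa).
Notation P := (@edge_reconnecting R n m kappa).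
Notation Z := (rising (n%:R * kappa) (2 * m)).
Implicit Types (s : (2 * m).-tuple 'I_n) (x y : multigraph n m).

Lemma total_gt0 : 0 < total.
Proof. by rewrite ltr_wpDl // mulr_gt0 // ltr0n. Qed.

Lemma rising_total_gt0 : 0 < Z.
Proof. by apply: rising_gt0; rewrite mulr_gt0 // ltr0n. Qed.

Lemma odd_size_pag s : ~~ odd (size s).
Proof. by rewrite size_tuple mul2n odd_double. Qed.

Lemma pag_mx_multigraph s :
  adjacency (pag_mx s) && (nedges (pag_mx s) == m).
Proof.
rewrite pag_mx_adjacency ?odd_size_pag // pag_mx_nedges ?odd_size_pag //.
by rewrite size_tuple mul2n doubleK /=.
Qed.

Definition pag_graph s : multigraph n m := Multigraph (pag_mx_multigraph s).

Lemma pag_graphE s x : (pag_mx s == adjmx x) = (pag_graph s == x).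
Proof. by []. Qed.

Lemma pag_sequence_probE s : pag_sequence_prob kappa s = urn_weight kappa s / Z.
Proof.
have a0 : 'I_n := Ordinal hn.
rewrite -[in Z](size_tuple s) -(urn_prob_seq kappa a0) size_tuple.
by apply: eq_bigr => L _; rewrite (tnth_nth a0).
Qed.

Lemma card_pag_graph x :
  \sum_s (pag_graph s == x)%:R = (m`!)%:R * pairing_weight R (adjmx x).
Proof.
under eq_bigr do rewrite -pag_graphE.
case: x => B /= /andP[aB /eqP eB].
by rewrite mul2n sum_pag_mx.
Qed.

(** The number of preimages is positive. Hence facts about a row of [P] can be checked at a sequence
    representing the state. *)
Lemma pag_graph_surj x : exists s, pag_graph s = x.
Proof.
have [s /eqP sx|z] := pickP (fun s => pag_graph s == x); first by exists s.
have := card_pag_graph x; rewrite big1 => [|s _]; last by rewrite z.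
move/esym/eqP; rewrite gt_eqF // mulr_gt0 ?pairing_weight_gt0 //.
by rewrite ltr0n fact_gt0.
Qed.

Lemma PAG_E x : PAG n m kappa x =
  (\prod_(i < n) rising kappa (deg x i)) / Z * (m`!%:R * pairing_weight R (adjmx x)).
Proof.
rewrite ffunE -card_pag_graph mulr_sumr big_mkcond; apply: eq_bigr => s _ /=.
rewrite -pag_graphE; case: eqP => [sx|_]; last by rewrite mulr0.
rewrite mulr1 pag_sequence_probE; congr (_ / _); apply: eq_bigr => i _.
by rewrite -sx pag_mx_deg ?odd_size_pag.
Qed.

Lemma PAG_gt0 x : 0 < PAG n m kappa x.
Proof.
rewrite PAG_E; apply: mulr_gt0.
  apply: divr_gt0; last exact: rising_total_gt0.
  by apply: prodr_gt0 => i _; apply: rising_gt0.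
by rewrite mulr_gt0 ?pairing_weight_gt0 // ltr0n fact_gt0.
Qed.

(** The factor [c] moves inside the sum so that, term by term, a value depending on [x] can be
    rewritten through a sequence representing [x]. *)
Lemma PAG_mulE x c : PAG n m kappa x * c =
  \sum_(s : (2 * m).-tuple 'I_n) urn_weight kappa s / Z * (pag_graph s == x)%:R * c.
Proof.
rewrite ffunE big_mkcond big_distrl; apply: eq_bigr => s _ /=.
by rewrite -pag_graphE; case: eqP; rewrite ?mulr1 ?mulr0 // pag_sequence_probE.
Qed.

Lemma PAG_distribution : is_distribution (PAG n m kappa).
Proof.
split=> [x|]; first exact/ltW/PAG_gt0.
under eq_bigr do rewrite -[PAG _ _ _ _]mulr1 PAG_mulE.
rewrite exchange_big /= -[RHS](divff (lt0r_neq0 rising_total_gt0)).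
rewrite -[in X in _ = X / _]sum_urn_weight big_distrl; apply: eq_bigr => s _ /=.
rewrite (bigD1 (pag_graph s)) //= eqxx !mulr1 big1 ?addr0 // => x sx.
by rewrite eq_sym (negPf sx) mulr0 mul0r.
Qed.

(** A uniform edge with a fair choice of its end is a uniform position among [2 * m]. The displaced
    entry still counts in the multiplicities, since degrees are taken before the step. *)
Lemma edge_reconnecting_pag s y :
  P (pag_graph s) y =
  \sum_(k < 2 * m) \sum_v ((count_mem v s)%:R + kappa)
     * (pag_graph (tuple_set s k v) == y)%:R / (total * (2 * m)%:R).
Proof.
have a0 : 'I_n := Ordinal hn.
have m0 : m%:R != 0 :> R by rewrite pnatr_eq0 -lt0n.
have t0 := lt0r_neq0 total_gt0.
pose F (B : 'M[nat]_n) : R := (B == adjmx y)%:R.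
have dE v : deg (pag_mx s) v = count_mem v s by rewrite pag_mx_deg ?odd_size_pag.
transitivity (\sum_v ((count_mem v s)%:R + kappa) / (total * (2 * m)%:R) *
   \sum_(k < 2 * m) F (pag_mx (set_nth a0 s k v))); last first.
  rewrite exchange_big /=; apply: eq_bigr => v _; rewrite big_distrr /=.
  apply: eq_bigr => k _; rewrite mulrAC -pag_graphE.
  by rewrite -(tuple_set_nth _ _ _ a0).
(* The sum over positions becomes a sum over edges and their ends by [sum_reconnect], started with
   no treated edge. *)
transitivity (\sum_v ((count_mem v s)%:R + kappa) / (total * (2 * m)%:R) *
  \sum_(i < n) \sum_(j < n | (j <= i)%N) (edge_mult (pag_mx s) i j)%:R *
      (F (reconnect (pag_mx s) i j v) + F (reconnect (pag_mx s) j i v))); last first.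
  apply: eq_bigr => v _; congr (_ * _).
  have := sum_reconnect F a0 v 0 (odd_size_pag s); rewrite add0r size_tuple => <-.
  by apply: eq_bigr => k _; rewrite add0r.
under [RHS]eq_bigr do rewrite mulr_sumr.
rewrite exchange_big /=; apply: eq_bigr => i _.
under [RHS]eq_bigr do rewrite mulr_sumr.
rewrite exchange_big /=; apply: eq_bigr => j _.
(* The two outcomes of the coin are the two summands, each with the weight [1 / (2 * m)] of a
   position. *)
rewrite big_bool /= -mulrDr -big_split /= mulrA mulr_sumr; apply: eq_bigr => v _.
rewrite dE -/(F _) -/(F _) natrM; field.
by rewrite m0 -natrM t0.
Qed.

Lemma PAG_reversible x y :
  PAG n m kappa x * P x y = PAG n m kappa y * P y x.
Proof.
(* Expanded over sequences, the flow becomes a sum over positions in which [urn_reversible]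
   exchanges the two indicators. *)
have flow z w : PAG n m kappa z * P z w =
  (Z * (total * (2 * m)%:R))^-1 * \sum_(k < 2 * m) \sum_(s : (2 * m).-tuple 'I_n) \sum_v
    urn_weight kappa s * ((count_mem v s)%:R + kappa) *
    ((pag_graph s == z)%:R * (pag_graph (tuple_set s k v) == w)%:R).
  rewrite PAG_mulE exchange_big mulr_sumr; apply: eq_bigr => s _ /=.
  case: eqP => [<-|_]; last first.
    rewrite mulr0 mul0r big1 ?mulr0 // => k _; rewrite big1 // => v _.
    by rewrite mul0r mulr0.
  rewrite edge_reconnecting_pag !mulr_sumr; apply: eq_bigr => k _.
  rewrite !mulr_sumr; apply: eq_bigr => v _; rewrite !invfM.
  by ring.
rewrite !flow; congr (_ * _); apply: eq_bigr => k _.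
rewrite (urn_reversible kappa k (fun s => (pag_graph s == x)%:R)
  (fun s => (pag_graph s == y)%:R)).
by apply: eq_bigr => s _; apply: eq_bigr => v _; congr (_ * _); rewrite mulrC.
Qed.

Lemma edge_reconnecting_ge0 x y : 0 <= P x y.
Proof.
have [s <-] := pag_graph_surj x; rewrite edge_reconnecting_pag.
apply: sumr_ge0 => k _; apply: sumr_ge0 => v _.
by rewrite !mulr_ge0 ?invr_ge0 ?mulr_ge0 ?addr_ge0 // ltW // mulr_gt0 // ltr0n.
Qed.

Lemma edge_reconnecting_sum1 x : \sum_y P x y = 1.
Proof.
have [s <-] := pag_graph_surj x; under eq_bigr do rewrite edge_reconnecting_pag.
rewrite exchange_big /=; under eq_bigr do rewrite exchange_big /=.
have t0 := lt0r_neq0 total_gt0.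
have m0 : m%:R != 0 :> R by rewrite pnatr_eq0 -lt0n.
have vE (k : 'I_(2 * m)) v : \sum_y ((count_mem v s)%:R + kappa)
     * (pag_graph (tuple_set s k v) == y)%:R / (total * (2 * m)%:R)
  = ((count_mem v s)%:R + kappa) / (total * (2 * m)%:R).
  rewrite (bigD1 (pag_graph (tuple_set s k v))) //= eqxx mulr1 big1 ?addr0 // => y sy.
  by rewrite eq_sym (negPf sy) mulr0 mul0r.
under eq_bigr do
  (under eq_bigr do rewrite vE; rewrite -mulr_suml sum_count_memR size_tuple).
rewrite sumr_const card_ord -mulr_natr; field.
by rewrite m0 -natrM t0.
Qed.

(** Since [kappa > 0], every vertex has a positive chance of being drawn, so the single term for [k]
    and [v] already makes the sum positive. *)
Lemma edge_reconnecting_tuple_set s (k : 'I_(2 * m)) v :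
  0 < P (pag_graph s) (pag_graph (tuple_set s k v)).
Proof.
have t0 : 0 < total * (2 * m)%:R.
  by rewrite mulr_gt0 ?total_gt0 // ltr0n muln_gt0.
have term_ge0 j u : 0 <= ((count_mem u s)%:R + kappa)
   * (pag_graph (tuple_set s j u) == pag_graph (tuple_set s k v))%:R / (total * (2 * m)%:R).
  by rewrite !mulr_ge0 ?invr_ge0 ?addr_ge0 // ltW.
rewrite edge_reconnecting_pag (bigD1 k) //= ltr_pwDl //; last first.
  by apply: sumr_ge0 => j _; apply: sumr_ge0.
rewrite (bigD1 v) //= ltr_pwDl ?sumr_ge0 // eqxx mulr1 divr_gt0 //.
by rewrite ltr_wpDl.
Qed.

Lemma edge_reconnecting_irreducible (A : {pred multigraph n m}) :
  (exists x, x \in A) -> (forall x y, x \in A -> 0 < P x y -> y \in A) ->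
  forall x, x \in A.
Proof.
case=> x0 Ax0 Acl x.
have [s s0] := pag_graph_surj x0; have [t <-] := pag_graph_surj x.
(* This interpolates from [s] to [t]: consecutive sequences differ in at most one entry, a step of
   positive probability. *)
pose mix j : (2 * m).-tuple 'I_n :=
  [tuple if (i < j)%N then tnth t i else tnth s i | i < 2 * m].
have mixA j : (j <= 2 * m)%N -> pag_graph (mix j) \in A.
  elim: j => [_|j IH jm].
    rewrite (_ : mix 0 = s) ?s0 //.
    by apply: eq_from_tnth => i; rewrite tnth_mktuple.
  rewrite (_ : mix j.+1 = tuple_set (mix j) (Ordinal jm) (tnth t (Ordinal jm))).
    by apply: Acl (IH (ltnW jm)) _; apply: edge_reconnecting_tuple_set.
  apply: eq_from_tnth => i; rewrite !tnth_mktuple ltnS leq_eqVlt -val_eqE /=.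
  by case: eqP => // ij; congr tnth; apply: val_inj.
rewrite (_ : t = mix (2 * m)) ?mixA //.
by apply: eq_from_tnth => i; rewrite tnth_mktuple ltn_ord.
Qed.

End Chain.

Theorem lemma2p1 (R : realType) (n m : nat) (kappa : R)
    (hn : (1 <= n)%N) (hm : (1 <= m)%N) (hkappa : 0 < kappa) :
  [/\ stationary (@edge_reconnecting R n m kappa) (PAG n m kappa),
      forall mu : {ffun multigraph n m -> R},
        stationary (@edge_reconnecting R n m kappa) mu -> mu = PAG n m kappa
    & forall B : multigraph n m,
        PAG n m kappa B =
          (\prod_(i < n) \prod_(1 <= j < (deg B i).+1) (kappa + j%:R - 1))
          / (\prod_(1 <= j < (2 * m).+1) (kappa * n%:R + j%:R - 1))
          * ((m`!)%:R * 2 ^+ nonloops B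
             / ((\prod_(i < n) \prod_(j < n | (j < i)%N) ((B i j)`!)%:R)
                * (\prod_(i < n) (((B i i)./2)`!)%:R)))].
Proof.
split=> [|mu|B].
- split=> [|y]; first exact: PAG_distribution.
  (* Summing the detailed balance over the source leaves the row sum at [y]. *)
  under eq_bigr do rewrite PAG_reversible //.
  by rewrite -big_distrr /= edge_reconnecting_sum1 // mulr1.
- apply: eq_stationary_reversible.
  + exact: PAG_gt0.
  + exact: PAG_distribution.
  + exact: edge_reconnecting_ge0.
  + exact: edge_reconnecting_sum1.
  + exact: PAG_reversible.
  + exact: edge_reconnecting_irreducible.
rewrite PAG_E // -risingE [n%:R * _]mulrC -[_ * 2 ^+ _ / _]mulrA.
by congr (_ / _ * _); apply: eq_bigr => i _; rewrite risingE.
Qed.
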